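(* Let $Q:U\to H$ and $Q_n:U\to H$, $n\in\mathbb{N}$, be weakly sequentially closed operators with $$\|Q(u)-Q_n(u)\|_H\le \epsilon_n\quad\text{for all } u\in\mathcal{C}_{ad},$$ and $\epsilon_n\downarrow 0$. Furthermore, let $(u_n)_{n\in\mathbb{N}}$ be a sequence such that, for each $n\in\mathbb{N}$, $u_n$ is a minimizer of $\tfrac12\|Q_n(u)-g\|_H^2+\tfrac{\alpha}{2}\|u\|_U^2$ over $u\in\mathcal{C}_{ad}$. Then we have the strong convergences $$u_n\to\bar u\ \text{ in } U\qquad\text{and}\qquad Q_n(u_n)\to Q(\bar u)\ \text{ in } H,\qquad\text{as } n\to\infty,$$ where $\bar u$ is a minimizer of $\tfrac12\|Q(u)-g\|_H^2+\tfrac{\alpha}{2}\|u\|_U^2$ over $u\in\mathcal{C}_{ad}$.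
   Context: $U$ and $H$ are Hilbert spaces, $g\in H$, $\alpha>0$, and $\mathcal{C}_{ad}\subset U$ is a nonempty, closed and convex set. An operator $Q:U\to H$ is weakly sequentially closed if $u_n\rightharpoonup u$ weakly in $U$ and $Q(u_n)\rightharpoonup\bar g$ weakly in $H$ imply $\bar g=Q(u)$.
   Formalization: As the limit problem may have several minimizers, u_n itself need not converge (Q=Q_n=x^2, g=2, alpha=2, u_n=(-1)^n); proved instead: every subsequence has a further subsequence with both convergences, and the whole sequences converge if the minimizer is unique. *)

(* Defs.v *)
From HB Require Import structures.
From mathcomp Require Import all_boot all_order all_algebra sesquilinear.
From mathcomp Require Import all_classical all_reals all_analysis.

Set Implicit Arguments.
Unset Strict Implicit.
Unset Printing Implicit Defensive.

Import Order.TTheory GRing.Theory Num.Theory.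
Import numFieldNormedType.Exports.

Local Open Scope classical_set_scope.
Local Open Scope ring_scope.

(* Real Hilbert spaces.  A complex Hilbert space is covered through its
   underlying real one, with inner product [Re <x, y>]: the norm, convexity,
   closedness and weak convergence are the same. *)
HB.mixin Record CompleteNormedModule_isHilbert (R : realType) U
    & CompleteNormedModule R U := {
  inner : {dot U for (@idfun R)} ;
  innerE : forall u : U, inner u u = `|u| ^+ 2
}.

#[short(type="hilbertType")]
HB.structure Definition Hilbert (R : realType) :=
  {U of CompleteNormedModule R U & CompleteNormedModule_isHilbert R U}.

(* Weak convergence is tested against the topological dual; [R^o] is [R] seen
   as a normed space over itself. *)
Definition weak_cvg (R : realType) (V : normedModType R) (u : nat -> V)
    (l : V) : Prop :=
  forall f : {linear V -> R^o}, continuous f -> f (u n) @[n --> \oo] --> f l.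

Definition weakly_sequentially_closed (R : realType) (U H : normedModType R)
    (Q : U -> H) : Prop :=
  forall (u : nat -> U) (l : U) (gbar : H),
    weak_cvg u l -> weak_cvg (Q \o u) gbar -> gbar = Q l.

Definition tikhonov (R : realType) (U H : normedModType R) (Q : U -> H)
    (g : H) (alpha : R) (u : U) : R :=
  1 / 2 * `|Q u - g| ^+ 2 + alpha / 2 * `|u| ^+ 2.

Definition is_minimizer (R : realType) (T : Type) (J : T -> R) (C : set T)
    (u : T) : Prop :=
  C u /\ forall v, C v -> J u <= J v.

(* Main.v *)
Require Import Defs.
From HB Require Import structures.
From mathcomp Require Import all_boot all_order all_algebra sesquilinear.
From mathcomp Require Import all_classical all_reals all_analysis.
From mathcomp Require Import ring lra.

Set Implicit Arguments.
Unset Strict Implicit.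
Unset Printing Implicit Defensive.

Import Order.TTheory GRing.Theory Num.Theory.
Import numFieldNormedType.Exports.

Local Open Scope classical_set_scope.
Local Open Scope ring_scope.

(** The argument compares minimal values, with weak compactness as its only
    analytic input.

    The values at the minimizers are bounded, so [u n] and [Q (u n)] are bounded
    ([minimizers_bounded]) and, along a subsequence, converge weakly
    ([bounded_weak_subseq]). The weak limit [ubar] of [u n] lies in the closed
    convex set [C] ([weak_limit_closed_convex]), and that of [Q (u n)] is
    [Q ubar] by weak sequential closedness. As [Q (u n)] and [Qn n (u n)] differ
    by at most [eps n], the latter has the same weak limit.

    Expanding squares, the weighted sum of the squared distances of [Qn n (u n)]
    to [Q ubar] and of [u n] to [ubar] is the value of the [n]-th functional at
    [u n], up to constants and pairings with fixed vectors, which converge. That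
    value is at most the value at any competitor [w] in [C], which tends to the
    value of the limit functional at [w]. In the limit, the nonnegative sum is at
    most the value of the limit functional at [w] minus that at [ubar]. Hence
    [ubar] is a minimizer, and [w = ubar] shows that the sum tends to zero, which
    gives both strong convergences at once ([minimizers_weak_limit]).

    When the minimizer is unique, all subsequences lead to the same limit and
    the whole sequence converges ([cvg_of_subsubseq]).

    Weak compactness rests on the nearest point in a closed convex set
    ([closed_convex_projection]), from which orthogonal projection onto closed
    subspaces and the Riesz representation of functionals follow. *)

(** * Inner product identities *)

Lemma innerC (R : realType) (U : hilbertType R) (x y : U) :
  inner x y = inner y x.
Proof. by rewrite hermC /= expr0 mul1r. Qed.

Lemma innerBl (R : realType) (U : hilbertType R) (x y z : U) :
  inner (x - y) z = inner x z - inner y z.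
Proof. exact: linearBl. Qed.

Lemma innerBr (R : realType) (U : hilbertType R) (x y z : U) :
  inner x (y - z) = inner x y - inner x z.
Proof. by rewrite innerC innerBl ![inner x _]innerC. Qed.

Lemma innerPr (R : realType) (U : hilbertType R) (a : R) (x y z : U) :
  inner x (a *: y + z) = a * inner x y + inner x z.
Proof. by rewrite linearDr linearZr. Qed.

Lemma innerZr (R : realType) (U : hilbertType R) (a : R) (x y : U) :
  inner x (a *: y) = a * inner x y.
Proof. by rewrite linearZr. Qed.

Lemma innerNr (R : realType) (U : hilbertType R) (x y : U) :
  inner x (- y) = - inner x y.
Proof. by rewrite linearNr. Qed.

Lemma inner_normB (R : realType) (U : hilbertType R) (x y : U) :
  `|x - y| ^+ 2 = `|x| ^+ 2 - 2 * inner x y + `|y| ^+ 2.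
Proof. rewrite -!innerE innerBl !innerBr [inner y x]innerC; ring. Qed.

(** The norm comes with its triangle inequality; squaring
    [`|x + y| <= `|x| + `|y|] bounds [inner x y] from above, and [- x] in place
    of [x] gives the other sign. *)
Lemma inner_CauchySchwarz (R : realType) (U : hilbertType R) (x y : U) :
  `|inner x y| <= `|x| * `|y|.
Proof.
wlog i_ge0 : x / 0 <= inner x y.
  move=> CS; have [/CS//|i_lt0] := leP 0 (inner x y).
  have NxyE : inner (- x) y = - inner x y by rewrite linearNl.
  by have := CS (- x); rewrite NxyE !normrN; apply; rewrite oppr_ge0 ltW.
have := inner_normB x (- y).
have := ler_normD x y; rewrite ger0_norm// opprK normrN innerNr => xy e.
have : `|x + y| ^+ 2 <= (`|x| + `|y|) ^+ 2 by rewrite lerXn2r ?nnegrE ?addr_ge0.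
rewrite e; nra.
Qed.

(** * Sequences and filters *)

Lemma ultra_fmap (S T : Type) (f : S -> T) (F : set_system S) :
  UltraFilter F -> UltraFilter (f @ F).
Proof.
move=> FU; apply: Build_UltraFilter => G GP FG.
apply/seteqP; split => // A GA.
have [//|FCA] := in_ultra_setVsetC (f @^-1` A) FU.
have GCA : G (~` A) by apply: FG.
by have [t []] := filter_ex (filterI GA GCA).
Qed.

(** The diagonal construction behind every extraction below: the k-th index is
    chosen beyond the previous one among those satisfying the k-th condition. *)
Lemma frequently_subseq (P : nat -> set nat) :
  (forall k N, exists n, (N <= n)%N /\ P k n) ->
  exists psi : nat -> nat, increasing_seq psi /\ forall k, P k (psi k).
Proof.
move=> Pex.
have /choice[g gP] : forall k, exists g : nat -> nat,
    forall N, (N <= g N)%N /\ P k (g N).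
  by move=> k; have [g gP] := choice (Pex k); exists g.
pose psi := fix psi k := if k is j.+1 then g k (psi j).+1 else g 0 0.
exists psi; split; last by case=> [|k]; exact: (gP _ _).2.
by apply/increasing_seqP => k; exact: (gP k.+1 (psi k).+1).1.
Qed.

Lemma increasing_seq_cvg (psi : nat -> nat) :
  increasing_seq psi -> psi n @[n --> \oo] --> \oo.
Proof.
move=> /increasing_seqP psi_incr A [N _ NA].
exists N => // n /= Nn.
apply: NA => /=; apply: leq_trans Nn _.
by elim: n => // n IHn; exact: leq_ltn_trans IHn (psi_incr n).
Qed.

(** Otherwise infinitely many terms stay at distance at least some [e] from [l],
    and the subsequence formed by them has no subsequence tending to [l]. *)
Lemma cvg_of_subsubseq (R : realType) (V : normedModType R) (x : nat -> V)
    (l : V) :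
  (forall phi : nat -> nat, increasing_seq phi ->
    exists2 psi : nat -> nat,
      increasing_seq psi & x (phi (psi n)) @[n --> \oo] --> l) ->
  x n @[n --> \oo] --> l.
Proof.
move=> xl; apply/cvgrPdist_lt => e e_gt0; apply: contrapT => not_near.
have far (k N : nat) : exists n, (N <= n)%N /\ e <= `|l - x n|.
  apply: contrapT => no_n; apply: not_near; exists N => // n /= Nn.
  by rewrite ltNge; apply/negP => le_e; apply: no_n; exists n.
have [phi [phi_incr phi_far]] :=
  frequently_subseq (P := fun=> [set n | e <= `|l - x n|]) far.
have [psi _ /cvgrPdist_lt /(_ _ e_gt0) near_l] := xl phi phi_incr.
by have [n /=] := filter_ex near_l; rewrite ltNge phi_far.
Qed.

Lemma cvg_norm_sqr_le (R : realType) (V : normedModType R) (x : nat -> V)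
    (l : V) (b : nat -> R) :
  (forall n, `|x n - l| ^+ 2 <= b n) -> b n @[n --> \oo] --> 0 ->
  x n @[n --> \oo] --> l.
Proof.
move=> xb b0; apply/cvgrPdist_lt => e e_gt0.
have e2_gt0 : 0 < e ^+ 2 by rewrite exprn_gt0.
have /cvgrPdist_lt /(_ _ e2_gt0) := b0; apply: filterS => n.
rewrite sub0r normrN => be.
rewrite -(ltr_pXn2r (n:=2)) ?nnegrE ?normr_ge0 ?ltW//.
by rewrite distrC (le_lt_trans (xb n))// (le_lt_trans (ler_norm _)).
Qed.

Lemma cvg_dist_le (R : realType) (V : normedModType R) (x y : nat -> V)
    (l : V) (e : nat -> R) :
  (forall n, `|x n - y n| <= e n) -> e n @[n --> \oo] --> 0 ->
  x n @[n --> \oo] --> l -> y n @[n --> \oo] --> l.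
Proof.
move=> xye e0 xl.
have xy0 : x n - y n @[n --> \oo] --> (0 : V).
  apply: norm_cvg0; apply: (squeeze_cvgr _ (cvg_cst 0) e0).
  by apply: nearW => n; rewrite normr_ge0 xye.
have : x n - (x n - y n) @[n --> \oo] --> l - 0 by exact: cvgB.
rewrite subr0.
by under eq_fun do rewrite subKr.
Qed.

Lemma cvg_real_ubound (R : realType) (u : nat -> R) (l : R) :
  u n @[n --> \oo] --> l -> exists2 K, 0 < K & forall n, u n <= K.
Proof.
move=> /cvgP/cvg_seq_bounded[K [_ uK]]; exists (`|K| + 1).
  by rewrite ltr_wpDl.
move=> n; rewrite (le_trans (ler_norm _))//; apply: uK => //.
by rewrite (le_lt_trans (ler_norm _))// ltrDl.
Qed.

(** * Projection and duality *)

(** A sequence in [C] minimizing the distance to [z] is Cauchy by the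
    parallelogram law, because midpoints stay in [C]; its limit [p] is a nearest
    point. Moving from [p] towards [c] does not decrease the distance to [z],
    and the first order part of this is the stated inequality. *)
Lemma closed_convex_projection (R : realType) (U : hilbertType R) (C : set U)
    (z : U) :
  C !=set0 -> closed C -> convex_set C ->
  exists2 p, C p & forall c, C c -> inner (z - p) (c - p) <= 0.
Proof.
move=> [c0 Cc0] C_closed C_convex.
have mix_C a b (t : R) : 0 <= t <= 1 -> C a -> C b -> C (t *: a + (1 - t) *: b).
  move=> /andP[t0 t1] Ca Cb.
  have := C_convex a b (Itv01 t0 t1); rewrite !inE; exact.
pose D : set R := [set `|z - c| ^+ 2 | c in C].
have D_lb : has_lbound D by exists 0 => _ [c _ <-]; rewrite exprn_ge0.
have D_inf : has_inf D by split=> //; exists (`|z - c0| ^+ 2), c0.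
have inf_le c : C c -> inf D <= `|z - c| ^+ 2.
  by move=> Cc; apply: ge_inf => //; exists c.
have /choice[c cP] : forall n : nat, exists c, C c /\
    `|z - c| ^+ 2 < inf D + n.+1%:R^-1.
  move=> n; have [|_ [c Cc <-] ?] := @inf_adherent _ D n.+1%:R^-1 _ D_inf.
    by rewrite invr_gt0.
  by exists c.
have c_close n m : `|c n - c m| ^+ 2 <= 2 * (n.+1%:R^-1 + m.+1%:R^-1).
  have [[Cn ltn] [Cm ltm]] := (cP n, cP m).
  have half01 : 0 <= (2^-1 : R) <= 1 by lra.
  (* The midpoint of [c n] and [c m] is no closer to [z] than [inf D] allows. *)
  have := inf_le _ (mix_C _ _ _ half01 Cn Cm).
  have -> : z - (2^-1 *: c n + (1 - 2^-1) *: c m) =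
      2^-1 *: ((z - c n) - - (z - c m)).
    have -> : 1 - 2^-1 = 2^-1 :> R by lra.
    rewrite -scalerDr opprK addrACA -opprD scalerBr; congr (_ - _).
    by rewrite -mulr2n -[z *+ 2]scaler_nat scalerA mulVf ?scale1r.
  rewrite normrZ exprMn (inner_normB (z - c n) (- (z - c m))) normrN innerNr.
  have -> : c n - c m = (z - c m) - (z - c n).
    by rewrite opprB [RHS]addrC addrA subrK.
  rewrite (inner_normB (z - c m)) [inner (z - c m) _]innerC.
  rewrite ger0_norm ?invr_ge0//.
  move: ltn ltm; move: n.+1%:R^-1 m.+1%:R^-1 => en em.
  lra.
have /cvg_ex[p cp] : cvg (c @ \oo).
  apply: cauchy_cvg; apply/cauchy_exP => e e_gt0.
  have e4_gt0 : 0 < e ^+ 2 / 4 by rewrite divr_gt0 ?exprn_gt0.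
  have [N _ NP] := near_infty_natSinv_lt (PosNum e4_gt0).
  exists (c N), N => // n Nn /=; rewrite -ball_normE /=.
  rewrite -(ltr_pXn2r (n:=2)) ?nnegrE ?normr_ge0 ?ltW//.
  have := c_close N n; have := NP N (leqnn N); have := NP n Nn => /=.
  by move: n.+1%:R^-1 N.+1%:R^-1 => en eN; lra.
have Cp : C p.
  apply: (closed_cvg C C_closed _ p cp).
  by apply: nearW => n; have [] := cP n.
have zp_le : `|z - p| ^+ 2 <= inf D.
  have lim_dist :
      `|z - c n| ^+ 2 - n.+1%:R^-1 @[n --> \oo] --> `|z - p| ^+ 2 - 0.
    apply: cvgB; last exact: cvg_harmonic.
    have zc : `|z - c n| @[n --> \oo] --> `|z - p|.
      by apply: cvg_norm; apply: cvgB cp; exact: cvg_cst.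
    by rewrite expr2; under eq_fun do rewrite expr2; exact: cvgM.
  rewrite -[leLHS]subr0.
  apply: (closed_cvg _ (@closed_le _ (inf D)) _ _ lim_dist).
  by apply: nearW => n /=; have [_ /ltW] := cP n; rewrite lerBlDr.
exists p => // b Cb.
have step t : 0 < t <= 1 -> 2 * inner (z - p) (b - p) <= t * `|b - p| ^+ 2.
  move=> /andP[t0 t1]; have := inf_le _ (mix_C b p t _ Cb Cp).
  have -> : z - (t *: b + (1 - t) *: p) = (z - p) - t *: (b - p).
    by rewrite scalerBl scale1r scalerBr -[RHS]addrA -opprD addrCA.
  rewrite inner_normB innerZr normrZ exprMn ger0_norm ?(ltW t0)// t1.
  move=> /(_ isT) h; rewrite -(ler_pM2l t0); lra.
rewrite leNgt; apply/negP => i_gt0.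
set i := inner _ _ in step i_gt0; set w := `|b - p| ^+ 2 in step.
have w_ge0 : 0 <= w by rewrite exprn_ge0.
have s_gt0 : 0 < i + w + 1 by lra.
(* A step length [t] for which [t * w] stays below [2 * i]. *)
have /step : 0 < i / (i + w + 1) <= 1.
  by rewrite divr_gt0//= ler_pdivrMr// mul1r; lra.
rewrite mulrAC ler_pdivlMr//; nra.
Qed.

Lemma closed_subspace_projection (R : realType) (U : hilbertType R)
    (V : set U) (z : U) :
  V 0 -> (forall a x y, V x -> V y -> V (a *: x + y)) -> closed V ->
  exists2 p, V p & forall v, V v -> inner (z - p) v = 0.
Proof.
move=> V0 V_lin V_closed.
have V_convex : convex_set V.
  move=> x y l; rewrite !inE => Vx Vy.
  by apply: (V_lin) => //; rewrite -[_ *: y]addr0; exact: V_lin.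
have [|p Vp p_le] := closed_convex_projection z _ V_closed V_convex.
  by exists 0.
exists p => // v Vv; apply/eqP; rewrite eq_le; apply/andP; split.
  by have := p_le _ (V_lin 1 v p Vv Vp); rewrite scale1r addrK.
have := p_le _ (V_lin (-1) v p Vv Vp).
by rewrite scaleN1r addrK innerNr oppr_le0.
Qed.

(** For [f] nonzero, the representing vector is a multiple of a vector [q]
    orthogonal to the kernel of [f]: every [x] differs from a multiple of [q] by
    an element of the kernel. *)
Lemma Riesz_representation (R : realType) (U : hilbertType R) (f : U -> R^o) :
  scalar f -> continuous f -> exists y, forall x, f x = inner y x.
Proof.
move=> f_lin f_cont.
have f0 : f 0 = 0.
  by have := f_lin (-1) 0 0; rewrite scaler0 addr0 mulN1r addNr.
pose K := [set x | f x = 0].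
have K_lin a x y : K x -> K y -> K (a *: x + y).
  by rewrite /K /= f_lin => -> ->; rewrite mulr0 addr0.
have K_closed : closed K.
  have -> : K = f @^-1` [set 0] by [].
  by apply: closed_comp => [x _|]; [exact: f_cont | exact: closed_eq].
have [fz|/existsNP[w fw]] := pselect (forall x, f x = 0).
  by exists 0 => x; rewrite fz linear0l.
have [p Kp p_orth] := closed_subspace_projection w f0 K_lin K_closed.
set q := w - p in p_orth.
have fq : f q = f w.
  by rewrite /q addrC -scaleN1r f_lin Kp mulr0 add0r.
have fq0 : f q != 0 by rewrite fq; apply/eqP.
have q0 : inner q q != 0.
  rewrite innerE sqrf_eq0 normr_eq0.
  by apply: contra_neq fq0 => ->.
exists ((f q / inner q q) *: q) => x.
have /p_orth : K (- (f x / f q) *: q + x).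
  by rewrite /K /= f_lin mulNr divfK // addNr.
rewrite innerPr [inner (_ *: q) x]innerC innerZr [inner x q]innerC.
move=> /eqP; rewrite mulNr addrC subr_eq0 => /eqP ->.
by field; rewrite fq0 q0.
Qed.

(** Riesz' theorem reduces weak convergence to pairings with vectors, the form
    in which weak convergence is produced and used below. *)
Lemma inner_cvg_weak_cvg (R : realType) (U : hilbertType R) (x : nat -> U)
    (y : U) :
  (forall z, inner (x n) z @[n --> \oo] --> inner y z) -> weak_cvg x y.
Proof.
move=> xy f f_cont; have [|z fE] := @Riesz_representation _ _ f _ f_cont.
  by move=> a u v; exact: linearP.
rewrite fE innerC; under eq_fun do rewrite fE innerC.
exact: xy.
Qed.

(** The projection [p] of the weak limit [y] satisfies
    [inner (y - p) (x n - p) <= 0] for all [n]; in the limit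
    [`|y - p| ^+ 2 <= 0], so that [y = p] lies in [C]. *)
Lemma weak_limit_closed_convex (R : realType) (U : hilbertType R) (C : set U)
    (x : nat -> U) (y : U) :
  closed C -> convex_set C -> (forall n, C (x n)) ->
  (forall z, inner (x n) z @[n --> \oo] --> inner y z) -> C y.
Proof.
move=> C_closed C_convex Cx xy.
have [|p Cp p_le] := closed_convex_projection y _ C_closed C_convex.
  by exists (x 0%N).
suff /eqP : `|y - p| ^+ 2 = 0.
  by rewrite sqrf_eq0 normr_eq0 subr_eq0 => /eqP ->.
apply/eqP; rewrite eq_le exprn_ge0// andbT -innerE [inner _ (y - p)]innerBr.
have lim : inner (y - p) (x n) - inner (y - p) p @[n --> \oo] -->
    inner (y - p) y - inner (y - p) p.
  apply: cvgB; last exact: cvg_cst.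
  by rewrite innerC; under eq_fun do rewrite innerC; exact: xy.
apply: (closed_cvg _ (@closed_le _ 0) _ _ lim).
by apply: nearW => n /=; rewrite -innerBr; exact: p_le.
Qed.

(** * Weak sequential compactness *)

(** Along an ultrafilter every bounded real sequence converges, so all pairings
    [inner (x n) z] have limits at once. These limits form a bounded linear
    functional of [z], represented by the weak limit. *)
Lemma weak_cluster_point (R : realType) (U : hilbertType R) (x : nat -> U)
    (M : R) (G : set_system nat) :
  UltraFilter G -> (forall n, `|x n| <= M) ->
  exists y, forall z, inner (x n) z @[n --> G] --> inner y z.
Proof.
move=> GU xM.
have ix_le n z : `|inner (x n) z| <= M * `|z|.
  by rewrite (le_trans (inner_CauchySchwarz _ _))// ler_wpM2r.
have /choice[L LP] : forall z, exists l : R, inner (x n) z @[n --> G] --> l.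
  move=> z; have := @segment_compact R (- (M * `|z|)) (M * `|z|).
  rewrite compact_ultra => cpt.
  have [|l [_ xl]] :=
      cpt _ (ultra_fmap (fun n => inner (x n) z) GU); last by exists l.
  apply: (@filterE _ G) => n /=.
  by rewrite in_itv /=; have := ix_le n z; rewrite ler_norml.
have L_lin : scalar L.
  move=> a u v; apply: (cvg_unique (@Rhausdorff R) (LP _)).
  have : a * inner (x n) u + inner (x n) v @[n --> G] --> a * L u + L v.
    by apply: cvgD; [apply: cvgM; [exact: cvg_cst|exact: LP]|exact: LP].
  by under eq_fun do rewrite -innerPr.
have L_le z : `|L z| <= M * `|z|.
  apply: (closed_cvg _ (@closed_le _ (M * `|z|)) _ _ (cvg_norm (LP z))).
  by apply: (@filterE _ G) => n; exact: ix_le.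
have L_cont : continuous (L : U -> R^o).
  move=> z; apply/cvgrPdist_le => e e_gt0.
  have M1_gt0 : 0 < `|M| + 1 by rewrite ltr_wpDl.
  have d_gt0 : 0 < e / (`|M| + 1) by rewrite divr_gt0.
  near=> t.
  have -> : L z - L t = L (z - t).
    by rewrite [z - t]addrC -[- t]scaleN1r L_lin mulN1r addrC.
  rewrite (le_trans (L_le _))//.
  have : `|z - t| <= e / (`|M| + 1) by near: t; exact: cvgr_dist_le.
  rewrite ler_pdivlMr//; apply: le_trans; rewrite mulrC ler_wpM2l//.
  by rewrite (le_trans (ler_norm _))// lerDl.
have [y Ly] := Riesz_representation L_lin L_cont.
by exists y => z; rewrite -Ly; exact: LP.
Unshelve. all: by end_near. Qed.

(** The [z] at which a bounded sequence converges form a closed subspace: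
    by boundedness, moving [z] slightly changes all pairings slightly. This
    subspace contains every [w m] and every vector orthogonal to all of them,
    hence everything. *)
Lemma weak_cvg_on_span (R : realType) (U : hilbertType R) (x w : nat -> U)
    (y : U) (M : R) :
  (forall n, `|x n| <= M) ->
  (forall m, inner (x n) (w m) @[n --> \oo] --> inner y (w m)) ->
  (forall z, (forall m, inner (w m) z = 0) ->
    inner (x n) z @[n --> \oo] --> inner y z) ->
  forall z, inner (x n) z @[n --> \oo] --> inner y z.
Proof.
move=> xM x_w x_perp z.
pose D := [set z | inner (x n) z @[n --> \oo] --> inner y z].
have D0 : D 0.
  rewrite /D /= linear0r; under eq_fun do rewrite linear0r.
  exact: cvg_cst.
have D_lin a u v : D u -> D v -> D (a *: u + v).
  move=> Du Dv; rewrite /D /= innerPr; under eq_fun do rewrite innerPr.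
  by apply: cvgD => //; apply: cvgM => //; exact: cvg_cst.
have D_closed : closed D.
  move=> u Du; apply/cvgrPdist_le => e e_gt0.
  pose K := `|M| + `|y| + 1.
  have K_gt0 : 0 < K by rewrite ltr_wpDl// addr_ge0.
  have d_gt0 : 0 < e / 2 / K by rewrite !divr_gt0.
  have [v [Dv /=]] := Du _ (nbhsx_ballx u _ d_gt0).
  rewrite -ball_normE /= ltr_pdivlMr// => uv.
  have e2_gt0 : 0 < e / 2 by rewrite divr_gt0.
  have /cvgrPdist_le /(_ _ e2_gt0) := Dv.
  apply: filterS => n yxv.
  (* [K] bounds [`|y - x n|], so that [u] may be replaced by [v]. *)
  have -> : inner y u - inner (x n) u =
      inner (y - x n) (u - v) + (inner y v - inner (x n) v).
    by rewrite innerBr !innerBl; ring.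
  rewrite (le_trans (ler_normD _ _))// [e]splitr lerD//.
  rewrite (le_trans (inner_CauchySchwarz _ _))// (le_trans _ (ltW uv))//.
  rewrite mulrC ler_wpM2l// (le_trans (ler_normB _ _))//.
  have := xM n; have := ler_norm M; rewrite /K; lra.
have [p Dp p_orth] := closed_subspace_projection z D0 D_lin D_closed.
rewrite -[z](subrK p) -[z - p]scale1r; apply: (D_lin) => //.
by apply: x_perp => m; rewrite innerC; apply: p_orth; exact: x_w.
Qed.

(** A weak cluster point [y] along an ultrafilter is turned into the limit of a
    subsequence: the diagonal construction ensures convergence against each of
    the countably many [x m]. A vector orthogonal to all [x m] pairs to zero
    with the sequence, hence with [y] too, so that [weak_cvg_on_span] extends the
    convergence to all of [U], separable or not. *)
Lemma bounded_weak_subseq (R : realType) (U : hilbertType R) (x : nat -> U)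
    (M : R) :
  (forall n, `|x n| <= M) ->
  exists (psi : nat -> nat) (y : U), increasing_seq psi /\
    forall z, inner (x (psi n)) z @[n --> \oo] --> inner y z.
Proof.
move=> xM.
have [G [GU ooG]] := @ultraFilterLemma nat \oo _.
have [y xy] := weak_cluster_point GU xM.
pose P k := [set n | forall m : 'I_k,
  `|inner y (x m) - inner (x n) (x m)| <= k.+1%:R^-1].
have [k N|psi [psi_incr psiP]] := @frequently_subseq P.
  have GN : G [set n | (N <= n)%N] by apply: ooG; exists N.
  have GP : G (P k).
    apply: filter_forall => m.
    by have /cvgrPdist_le := xy (x m); apply; rewrite invr_gt0.
  by have [n [Nn Pn]] := filter_ex (filterI GN GP); exists n.
exists psi, y; split=> //.
apply: (@weak_cvg_on_span _ _ _ x _ M) => [n|m|z z_perp] //.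
  apply/cvgrPdist_le => e e_gt0.
  near=> k.
  have mk : (m < k)%N by near: k; exists m.+1.
  apply: le_trans (psiP k (Ordinal mk)) _.
  near: k; have := near_infty_natSinv_lt (PosNum e_gt0).
  by apply: filterS => k /ltW.
have xz0 : (fun n => inner (x n) z) = cst 0 by exact/funext.
have -> : inner y z = 0.
  by apply: (cvg_unique (@Rhausdorff R) (xy z)); rewrite xz0; exact: cvg_cst.
rewrite (_ : (fun n => inner (x (psi n)) z) = cst 0); first exact: cvg_cst.
by apply/funext => n; exact: z_perp.
Unshelve. all: by end_near. Qed.

(** * Stability of minimizers *)

Lemma tikhonov_cvg (R : realType) (U H : hilbertType R) (g : H) (alpha : R)
    (Q : U -> H) (P : nat -> U -> H) (v : U) :
  P n v @[n --> \oo] --> Q v ->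
  tikhonov (P n) g alpha v @[n --> \oo] --> tikhonov Q g alpha v.
Proof.
move=> Pv; apply: cvgD; last exact: cvg_cst.
apply: cvgM; first exact: cvg_cst.
have Pvg : `|P n v - g| @[n --> \oo] --> `|Q v - g|.
  by apply: cvg_norm; apply: cvgB => //; exact: cvg_cst.
by rewrite expr2; under eq_fun do rewrite expr2; exact: cvgM.
Qed.

Lemma tikhonov_excess (R : realType) (U H : hilbertType R) (alpha : R)
    (a a' : H) (b b' : U) :
  1 / 2 * `|a - a'| ^+ 2 + alpha / 2 * `|b - b'| ^+ 2 =
  1 / 2 * `|a| ^+ 2 + alpha / 2 * `|b| ^+ 2
  - (inner a a' + alpha * inner b b')
  + (1 / 2 * `|a'| ^+ 2 + alpha / 2 * `|b'| ^+ 2).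
Proof. by rewrite !inner_normB; field. Qed.

(** The excess [E n], a weighted squared distance of [(P n (v n), v n)] to
    [(Q ubar, ubar)], is by [tikhonov_excess] the minimal value at stage [n]
    corrected by terms that converge under weak convergence alone. Comparing
    that value with the one at a competitor [w] bounds [E n] by a sequence tending to
    [tikhonov Q g alpha w - tikhonov Q g alpha ubar]. As [E n] is nonnegative,
    [ubar] is a minimizer; and [w = ubar] gives the strong convergences. *)
Lemma minimizers_weak_limit (R : realType) (U H : hilbertType R) (g : H)
    (alpha : R) (C : set U) (Q : U -> H) (P : nat -> U -> H) (e : nat -> R)
    (v : nat -> U) (ubar : U) :
  0 < alpha ->
  (forall n w, C w -> `|Q w - P n w| <= e n) -> e n @[n --> \oo] --> 0 ->
  (forall n, is_minimizer (tikhonov (P n) g alpha) C (v n)) ->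
  C ubar ->
  (forall z, inner (v n) z @[n --> \oo] --> inner ubar z) ->
  (forall z, inner (Q (v n)) z @[n --> \oo] --> inner (Q ubar) z) ->
  [/\ is_minimizer (tikhonov Q g alpha) C ubar,
      v n @[n --> \oo] --> ubar & P n (v n) @[n --> \oo] --> Q ubar].
Proof.
move=> alpha_gt0 PQ e0 v_min Cubar v_weak Qv_weak.
have PvQ_weak z : inner (P n (v n)) z @[n --> \oo] --> inner (Q ubar) z.
  apply: (cvg_dist_le (e := fun n => e n * `|z|) _ _ (Qv_weak z)) => [n|].
    rewrite -innerBl (le_trans (inner_CauchySchwarz _ _))//.
    by rewrite ler_wpM2r// PQ//; have [] := v_min n.
  by rewrite -[X in _ --> X](mul0r `|z|); apply: cvgM => //; exact: cvg_cst.
pose a n := P n (v n) - g; pose a' := Q ubar - g.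
pose E n := 1 / 2 * `|a n - a'| ^+ 2 + alpha / 2 * `|v n - ubar| ^+ 2.
have E_ge0 n : 0 <= E n.
  by rewrite addr_ge0// mulr_ge0// ?exprn_ge0// divr_ge0// ltW.
pose B w n := tikhonov (P n) g alpha w
    - (inner (a n) a' + alpha * inner (v n) ubar) + tikhonov Q g alpha ubar.
have E_le_B w n : C w -> E n <= B w n.
  move=> Cw; rewrite /E tikhonov_excess lerD2r lerD2r.
  by have [_] := v_min n; exact.
have B_cvg w : C w ->
    B w n @[n --> \oo] --> tikhonov Q g alpha w - tikhonov Q g alpha ubar.
  move=> Cw.
  have -> : tikhonov Q g alpha w - tikhonov Q g alpha ubar =
      tikhonov Q g alpha w - (inner a' a' + alpha * inner ubar ubar)
      + tikhonov Q g alpha ubar.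
    by rewrite /tikhonov !innerE -/a'; field.
  apply: cvgD; last exact: cvg_cst.
  apply: cvgB.
    apply: tikhonov_cvg.
    apply: (cvg_dist_le _ e0 (cvg_cst (Q w))) => n; exact: PQ.
  apply: cvgD.
    rewrite [in X in _ --> X]/a' /a innerBl; under eq_fun do rewrite innerBl.
    by apply: cvgB; [exact: PvQ_weak|exact: cvg_cst].
  by apply: cvgM; [exact: cvg_cst|exact: v_weak].
have ubar_min : is_minimizer (tikhonov Q g alpha) C ubar.
  split=> // w Cw; rewrite -subr_ge0.
  apply: (closed_cvg _ (@closed_ge _ 0) _ _ (B_cvg w Cw)).
  by apply: nearW => n; exact: le_trans (E_ge0 n) (E_le_B w n Cw).
have E_cvg : E n @[n --> \oo] --> 0.
  have := B_cvg ubar Cubar; rewrite subrr.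
  apply: (squeeze_cvgr _ (cvg_cst 0)).
  by apply: nearW => n; rewrite E_ge0 E_le_B.
split=> //.
- apply: (cvg_norm_sqr_le (b := fun n => 2 / alpha * E n)) => [n|].
    rewrite /E mulrDr mulrA [_ / _ * (_ / _)]mulrC.
    have -> : 2 / alpha * (alpha / 2 * `|v n - ubar| ^+ 2) = `|v n - ubar| ^+ 2.
      by field; rewrite gt_eqF.
    by rewrite lerDr !mulr_ge0 ?invr_ge0// ltW.
  rewrite -[X in _ --> X](mulr0 (2 / alpha)).
  by apply: cvgM => //; exact: cvg_cst.
- apply: (cvg_norm_sqr_le (b := fun n => 2 * E n)) => [n|].
    have -> : P n (v n) - Q ubar = a n - a' by rewrite /a /a' opprB addrA subrK.
    have : 0 <= alpha / 2 * `|v n - ubar| ^+ 2.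
      by rewrite mulr_ge0// ?exprn_ge0// divr_ge0// ltW.
    rewrite /E; lra.
  rewrite -[X in _ --> X](mulr0 2).
  by apply: cvgM => //; exact: cvg_cst.
Qed.

(** The value of the approximate functionals at a fixed point of [C] converges,
    hence is bounded; it dominates the minimal values, which control both
    [`|v n|] and the residuals. *)
Lemma minimizers_bounded (R : realType) (U H : hilbertType R) (g : H)
    (alpha : R) (C : set U) (Q : U -> H) (P : nat -> U -> H) (e : nat -> R)
    (v : nat -> U) :
  0 < alpha -> C !=set0 ->
  (forall n w, C w -> `|Q w - P n w| <= e n) -> e n @[n --> \oo] --> 0 ->
  (forall n, is_minimizer (tikhonov (P n) g alpha) C (v n)) ->
  exists M, forall n, `|v n| <= M /\ `|Q (v n)| <= M.
Proof.
move=> alpha_gt0 [w Cw] PQ e0 v_min.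
have Pw : P n w @[n --> \oo] --> Q w.
  by apply: (cvg_dist_le _ e0 (cvg_cst (Q w))) => n; exact: PQ.
have [K K_gt0 JK] : exists2 K, 0 < K & forall n, tikhonov (P n) g alpha w <= K.
  exact: cvg_real_ubound (tikhonov_cvg Pw).
have [L L_gt0 eL] := cvg_real_ubound e0.
have le1sq (t : R) : t <= t ^+ 2 + 1 by have := sqr_ge0 (t - 1); nra.
have [v2 d2] : (forall n, `|v n| ^+ 2 <= 2 / alpha * K) /\
    (forall n, `|P n (v n) - g| ^+ 2 <= 2 * K).
  have JvK n : 1 / 2 * `|P n (v n) - g| ^+ 2 + alpha / 2 * `|v n| ^+ 2 <= K.
    by have [_ /(_ w Cw) le_w] := v_min n; exact: le_trans le_w (JK n).
  split=> n; have := JvK n; have := sqr_ge0 `|P n (v n) - g|;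
    have : 0 <= alpha / 2 * `|v n| ^+ 2
      by rewrite mulr_ge0// ?exprn_ge0// divr_ge0// ltW.
  - move=> _ d_ge0 JvKn; rewrite mulrAC ler_pdivlMr//; lra.
  - lra.
have a2_gt0 : 0 <= 2 / alpha * K by rewrite mulr_ge0// ?divr_ge0// ltW.
exists (2 / alpha * K + 1 + (L + (2 * K + 1) + `|g|)) => n; split.
  have := le1sq `|v n|; have := v2 n; have := normr_ge0 g; lra.
have -> : Q (v n) = (Q (v n) - P n (v n)) + (P n (v n) - g) + g.
  by rewrite addrA subrK subrK.
have := ler_normD (Q (v n) - P n (v n) + (P n (v n) - g)) g.
have := ler_normD (Q (v n) - P n (v n)) (P n (v n) - g).
have := PQ n (v n) (v_min n).1; have := eL n.
have := le1sq `|P n (v n) - g|; have := d2 n; lra.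
Qed.

(** Bounded sequences having weakly convergent subsequences, extraction is done
    first for [v n] and then for [Q (v n)]. The values of [Q], rather
    than those of the varying [P n], are extracted so that the weak sequential
    closedness of [Q] identifies the second limit. *)
Lemma minimizers_subseq_cvg (R : realType) (U H : hilbertType R) (g : H)
    (alpha : R) (C : set U) (Q : U -> H) (P : nat -> U -> H) (e : nat -> R)
    (v : nat -> U) :
  0 < alpha -> C !=set0 -> closed C -> convex_set C ->
  weakly_sequentially_closed Q ->
  (forall n w, C w -> `|Q w - P n w| <= e n) -> e n @[n --> \oo] --> 0 ->
  (forall n, is_minimizer (tikhonov (P n) g alpha) C (v n)) ->
  exists (psi : nat -> nat) (ubar : U),
    [/\ increasing_seq psi, is_minimizer (tikhonov Q g alpha) C ubar,
        v (psi n) @[n --> \oo] --> ubar &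
        P (psi n) (v (psi n)) @[n --> \oo] --> Q ubar].
Proof.
move=> alpha_gt0 C0 C_closed C_convex Q_closed PQ e0 v_min.
have [M vM] := minimizers_bounded alpha_gt0 C0 PQ e0 v_min.
have [psi1 [ubar [psi1_incr v_weak1]]] :=
  bounded_weak_subseq (fun n => (vM n).1).
have [psi2 [h [psi2_incr Qv_weak]]] :=
  bounded_weak_subseq (fun n => (vM (psi1 n)).2).
pose psi n := psi1 (psi2 n).
have psi_incr : increasing_seq psi.
  by move=> m n; exact: etrans (psi1_incr _ _) (psi2_incr _ _).
have v_weak z : inner (v (psi n)) z @[n --> \oo] --> inner ubar z.
  exact: (cvg_comp _ _ (increasing_seq_cvg psi2_incr) (v_weak1 z)).
have hE : h = Q ubar.
  apply: (Q_closed (fun n => v (psi n))); apply: inner_cvg_weak_cvg.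
    exact: v_weak.
  exact: Qv_weak.
rewrite {}hE in Qv_weak.
have Cubar : C ubar.
  apply: (weak_limit_closed_convex C_closed C_convex _ v_weak) => n.
  by have [] := v_min (psi n).
have epsi0 := cvg_comp _ _ (increasing_seq_cvg psi_incr) e0.
have [ubar_min v_cvg Pv_cvg] := minimizers_weak_limit alpha_gt0
  (fun n => PQ (psi n)) epsi0 (fun n => v_min (psi n)) Cubar v_weak Qv_weak.
by exists psi, ubar.
Qed.

(* A minimizer of the limit problem need not be unique, and then the whole
   sequence u need not converge (take Q_n = Q and alternate between two
   minimizers).  As usual in that case, "u_n -> ubar" is understood along
   subsequences, any subsequence having such a further subsequence; the whole
   sequence converges when the minimizer is unique. *)
Theorem theorem2p3 (R : realType) (U H : hilbertType R) (g : H) (alpha : R)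
    (C : set U) (Q : U -> H) (Qn : nat -> U -> H) (eps : nat -> R)
    (u : nat -> U)
    (alpha_gt0 : 0 < alpha)
    (C_neq0 : C !=set0) (C_closed : closed C) (C_convex : convex_set C)
    (Q_closed : weakly_sequentially_closed Q)
    (Qn_closed : forall n, weakly_sequentially_closed (Qn n))
    (QnQ : forall n v, C v -> `|Q v - Qn n v| <= eps n)
    (eps_noninc : nonincreasing_seq eps) (eps_cvg0 : eps n @[n --> \oo] --> 0)
    (u_min : forall n, is_minimizer (tikhonov (Qn n) g alpha) C (u n)) :
  (forall phi : nat -> nat, increasing_seq phi ->
    exists (psi : nat -> nat) (ubar : U),
      [/\ increasing_seq psi,
          is_minimizer (tikhonov Q g alpha) C ubar,
          u (phi (psi n)) @[n --> \oo] --> ubar &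
          Qn (phi (psi n)) (u (phi (psi n))) @[n --> \oo] --> Q ubar]) /\
  (forall ubar : U,
    is_minimizer (tikhonov Q g alpha) C ubar ->
    (forall v, is_minimizer (tikhonov Q g alpha) C v -> v = ubar) ->
    u n @[n --> \oo] --> ubar /\ Qn n (u n) @[n --> \oo] --> Q ubar).
Proof.
have subseq phi : increasing_seq phi -> exists (psi : nat -> nat) (ubar : U),
    [/\ increasing_seq psi, is_minimizer (tikhonov Q g alpha) C ubar,
        u (phi (psi n)) @[n --> \oo] --> ubar &
        Qn (phi (psi n)) (u (phi (psi n))) @[n --> \oo] --> Q ubar].
  move=> phi_incr.
  exact: (minimizers_subseq_cvg alpha_gt0 C_neq0 C_closed C_convex Q_closed
    (fun n => QnQ (phi n)) (cvg_comp _ _ (increasing_seq_cvg phi_incr) eps_cvg0)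
    (fun n => u_min (phi n))).
split=> // ubar _ ubar_uniq.
split.
- apply: cvg_of_subsubseq => phi /subseq[psi [v [psi_incr /ubar_uniq -> uv _]]].
  by exists psi.
- apply: (cvg_of_subsubseq (x := fun n => Qn n (u n))) => phi.
  by move=> /subseq[psi [v [psi_incr /ubar_uniq -> _ Quv]]]; exists psi.
Qed.
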